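(* Let $\Sigma$ be a finite signature. Two bar $\Sigma$-trees $s,t$ are $\alpha$-equivalent if and only if $\mathsf{nf}(s)=\mathsf{nf}(t)$.
   Context: $\mathbb A$ is a fixed countably infinite set of names; $\overline{\mathbb A}=\mathbb A\cup\{\vert a : a\in\mathbb A\}$, where $a$ is a plain name and $\vert a$ a bar name. A signature $\Sigma$ is a set of symbols with finite arities. A bar $\Sigma$-tree is a finite ordered tree (closed term) over the signature containing one $n$-ary symbol $\alpha.f$ for every $\alpha\in\overline{\mathbb A}$ and every $n$-ary $f\in\Sigma$. Finite permutations $\pi$ of $\mathbb A$ act by $\pi\cdot a=\pi(a)$, $\pi\cdot\vert a=\vert\pi(a)$ and $\pi\cdot(\alpha.f(t_1,\dots,t_n))=(\pi\cdot\alpha).f(\pi\cdot t_1,\dots,\pi\cdot t_n)$; $(a\ c)$ is the transposition of $a$ and $c$. For bar trees $t,t'$ write $\langle a\rangle t=\langle b\rangle t'$ iff $(a\ c)\cdot t=(b\ c)\cdot t'$ for some (equivalently every) name $c\notin\{a,b\}$ not occurring (plain or barred) in $t$ or $t'$. $\alpha$-equivalence $\equiv_\alpha$ is the least congruence on bar $\Sigma$-trees such that $\vert a.f(t_1,\dots,t_n)\equiv_\alpha\vert b.f(t_1',\dots,t_n')$ whenever $\langle a\rangle t_i=\langle b\rangle t_i'$ for all $1\le i\le n$. De Bruijn normal form of bar strings: for $w=\alpha_1\cdots\alpha_n\in\overline{\mathbb A}^*$, $\mathsf{nf}(w)=\beta_1\cdots\beta_n\in(\mathbb A+\mathbb N)^*$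 (disjoint union) is defined inductively by: (1) $\beta_i=\alpha_i$ if $\alpha_i\in\mathbb A$ and $\alpha_i$ is not preceded by any occurrence of $\vert\alpha_i$ in $w$; (2) $\beta_i=k$ if $\alpha_i\in\mathbb A$ and $\beta_j=k$ where $j=\max\{j<i:\alpha_j=\vert\alpha_i\}$; (3) $\beta_i=k+1$ if $\alpha_i$ is a bar name and $\alpha_1\cdots\alpha_{i-1}$ contains $k$ (occurrences of) bar names. De Bruijn normal form of a bar $\Sigma$-tree $t$: $\mathsf{nf}(t)$ is a tree of the same shape as $t$ over the signature $(\mathbb A+\mathbb N)\times\Sigma$ (symbols $\beta.f$ with $\beta\in\mathbb A+\mathbb N$, of the arity of $f$). For each node $x$ of $t$ with label $\alpha.f$, if $\alpha_1.f_1,\dots,\alpha_n.f_n,\alpha.f$ are the labels on the path from the root to $x$, the corresponding node of $\mathsf{nf}(t)$ has label $\beta.f$, where $\beta$ is the last letter of $\mathsf{nf}(\alpha_1\cdots\alpha_n\alpha)$. *)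

(* Defs.v *)
From HB Require Import structures.
From mathcomp Require Import all_boot.

Set Implicit Arguments.
Unset Strict Implicit.
Unset Printing Implicit Defensive.

(* [countType] only gives "at most countable"; this is the other half of
   "countably infinite". *)
Definition infinitely_many (A : eqType) : Prop :=
  forall s : seq A, exists a : A, a \notin s.

Inductive barname (A : Type) : Type :=
| Plain of A
| Bar of A.

Definition name_of (A : Type) (x : barname A) : A :=
  match x with Plain a => a | Bar a => a end.

Definition is_bar (A : Type) (x : barname A) : bool :=
  if x is Bar _ then true else false.

Definition barname_to_sum (A : Type) (x : barname A) : A + A :=
  match x with Plain a => inl a | Bar a => inr a end.

Definition barname_of_sum (A : Type) (x : A + A) : barname A :=
  match x with inl a => Plain a | inr a => Bar a end.

Lemma barname_to_sumK (A : Type) :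
  cancel (@barname_to_sum A) (@barname_of_sum A).
Proof. by case. Qed.

HB.instance Definition _ (A : eqType) :=
  Equality.copy (barname A) (can_type (@barname_to_sumK A)).

(* Closed terms over the signature with symbols [F] and arities [ar]; finite
   functions make equality of trees extensional in the children. *)
Inductive tree (F : Type) (ar : F -> nat) : Type :=
| Node (g : F) (ts : {ffun 'I_(ar g) -> tree ar}).

(* The arities of the signature [L * F], whose symbol [(l, f)] is "l.f". *)
Definition lab_arity (L F : Type) (ar : F -> nat) (g : L * F) : nat := ar g.2.

Definition ltree (L F : Type) (ar : F -> nat) : Type := tree (@lab_arity L F ar).

Definition LNode (L F : Type) (ar : F -> nat) (l : L) (f : F)
    (ts : {ffun 'I_(ar f) -> ltree L ar}) : ltree L ar :=
  @Node _ (@lab_arity L F ar) (l, f) ts.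

Definition bartree (A F : Type) (ar : F -> nat) : Type := ltree (barname A) ar.

Section AlphaEquivalence.
Variables (A : eqType) (F : Type) (ar : F -> nat).
Implicit Types (a b c : A) (t : bartree A ar).

Definition swap a c (x : A) : A :=
  if x == a then c else if x == c then a else x.

Definition rename_barname (p : A -> A) (x : barname A) : barname A :=
  match x with Plain a => Plain (p a) | Bar a => Bar (p a) end.

Fixpoint rename (p : A -> A) t : bartree A ar :=
  match t with
  | Node g ts => @LNode _ _ ar (rename_barname p g.1) g.2 [ffun i => rename p (ts i)]
  end.

Fixpoint names t : seq A :=
  match t with
  | Node g ts => name_of g.1 :: flatten (codom (names \o ts))
  end.

(* <a> t = <b> t' *)
Definition abs_eq a t b t' : Prop :=
  exists c : A,
    [/\ c != a, c != b, c \notin names t, c \notin names t'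
      & rename (swap a c) t = rename (swap b c) t'].

Inductive alpha_eq : bartree A ar -> bartree A ar -> Prop :=
| alpha_refl t : alpha_eq t t
| alpha_sym s t : alpha_eq s t -> alpha_eq t s
| alpha_trans s t u : alpha_eq s t -> alpha_eq t u -> alpha_eq s u
| alpha_congr (x : barname A) (f : F) (ss ts : {ffun 'I_(ar f) -> bartree A ar}) :
    (forall i, alpha_eq (ss i) (ts i)) -> alpha_eq (LNode x ss) (LNode x ts)
| alpha_bar a b (f : F) (ss ts : {ffun 'I_(ar f) -> bartree A ar}) :
    (forall i, abs_eq a (ss i) b (ts i)) ->
    alpha_eq (LNode (Bar a) ss) (LNode (Bar b) ts).

End AlphaEquivalence.

Section DeBruijn.
Variable A : eqType.

(* The letter of the normal form standing for [x], where [u] lists the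
   preceding letters paired with their own normal-form letters; the head of the
   reversed filtered list is the entry of the last preceding [Bar a]. *)
Definition nf_letter (u : seq (barname A * (A + nat))) (x : barname A) : A + nat :=
  match x with
  | Plain a =>
      if rev [seq y <- u | y.1 == Bar a] is y :: _ then y.2 else inl a
  | Bar _ => inr (count (fun y => is_bar y.1) u).+1
  end.

Definition nf_string (w : seq (barname A)) : seq (A + nat) :=
  unzip2 (foldl (fun u x => rcons u (x, nf_letter u x)) [::] w).

Variables (F : Type) (ar : F -> nat).

(* [w] is the string of bar names labelling the proper ancestors of the root of
   [t], from the top down. The default value of [last] is never used. *)
Fixpoint nf_below (w : seq (barname A)) (t : bartree A ar) : ltree (A + nat) ar :=
  match t with
  | Node g ts =>
      let w' := rcons w g.1 in
      @LNode _ _ ar (last (inr 0) (nf_string w')) g.2 [ffun i => nf_below w' (ts i)]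
  end.

Definition nf_tree (t : bartree A ar) : ltree (A + nat) ar := nf_below [::] t.

End DeBruijn.

(* Main.v *)
Require Import Defs.
From mathcomp Require Import all_boot.

(** The normal form is computed structurally from the number [k] of bar names
    above a node and an environment [e] giving the letter of each plain name.
    This map commutes with renaming, so it is invariant under alpha-equivalence.
    Conversely, bound letters are at most [k] and a bar name introduces the
    letter [k.+1], so environments stay injective along every path; given two
    trees with equal normal forms, one renames the two bar names at the root to
    a common fresh name and recurses in the children. *)

Set Implicit Arguments.
Unset Strict Implicit.
Unset Printing Implicit Defensive.

(** * Induction and injectivity for trees *)

Lemma tree_nested_ind (G : Type) (ar : G -> nat) (P : tree ar -> Prop) :
  (forall g (ts : {ffun 'I_(ar g) -> tree ar}),
     (forall i, P (ts i)) -> P (Node ts)) ->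
  forall t, P t.
Proof.
by move=> PN; fix IH 1 => -[g ts]; apply: PN => i; apply: IH.
Qed.

Lemma ltree_ind (L F : Type) (ar : F -> nat) (P : ltree L ar -> Prop) :
  (forall l f (ts : {ffun 'I_(ar f) -> ltree L ar}),
     (forall i, P (ts i)) -> P (LNode l ts)) ->
  forall t, P t.
Proof. by move=> PN; apply: tree_nested_ind => -[l f] ts; apply: PN. Qed.

(** The type of the children depends on the symbol, so they are compared through a cast along the
    equality of symbols. *)
Lemma LNode_inj (L F : Type) (ar : F -> nat) (l l' : L) (f f' : F)
    (ss : {ffun 'I_(ar f) -> ltree L ar})
    (ts : {ffun 'I_(ar f') -> ltree L ar}) :
  LNode l ss = LNode l' ts ->
  l = l' /\
  exists E : f = f', forall i, ss i = ts (cast_ord (congr1 ar E) i).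
Proof.
(* Matching on the tree lets [eq_st] be used by plain rewriting, without an equality of dependent
   pairs. *)
pose P (t : ltree L ar) := match t with Node g vs =>
  l = g.1 /\ exists E : f = g.2, forall i, ss i = vs (cast_ord (congr1 ar E) i)
  end.
move=> eq_st; suff: P (LNode l' ts) by [].
rewrite -eq_st; split=> //; exists erefl => i /=.
by congr (ss _); apply: val_inj.
Qed.

Lemma eq_LNode (L F : Type) (ar : F -> nat) (l l' : L) (f : F)
    (ss ts : {ffun 'I_(ar f) -> ltree L ar}) :
  l = l' -> (forall i, ss i = ts i) -> LNode l ss = LNode l' ts.
Proof. by move=> -> /ffunP ->. Qed.

(** * Renaming and fresh names *)

Section Renaming.
Variables (A : eqType) (F : Type) (ar : F -> nat).
Implicit Types (a c d : A) (t : bartree A ar) (p q : A -> A).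

Lemma swapK a c : involutive (swap a c).
Proof.
move=> x; rewrite /swap; have [->|xa] := eqVneq x a.
  by case: (eqVneq c a) => // _; rewrite eqxx.
have [->|xc] := eqVneq x c; first by rewrite eqxx.
by rewrite (negPf xa) (negPf xc).
Qed.

Lemma rename_LNode p x f (ts : {ffun 'I_(ar f) -> bartree A ar}) :
  rename p (LNode x ts) =
  LNode (rename_barname p x) [ffun i => rename p (ts i)].
Proof. by []. Qed.

Lemma mem_names_label x f (ts : {ffun 'I_(ar f) -> bartree A ar}) :
  name_of x \in names (LNode x ts).
Proof. exact: mem_head. Qed.

Lemma mem_names_child x f (ts : {ffun 'I_(ar f) -> bartree A ar}) i y :
  y \in names (ts i) -> y \in names (LNode x ts).
Proof.
move=> y_ts; rewrite inE; apply/orP; right; apply/flattenP.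
by exists (names (ts i)) => //; apply: (codom_f (@names A F ar \o ts)).
Qed.

Lemma eq_in_rename p q t :
  {in names t, p =1 q} -> rename p t = rename q t.
Proof.
elim/ltree_ind: t => x f ts IH eq_pq; rewrite !rename_LNode.
apply: eq_LNode => [|i].
  by have := eq_pq _ (mem_names_label x ts); case: x {eq_pq} => a /= ->.
rewrite !ffunE; apply: IH => y y_ts.
by apply: eq_pq; apply: mem_names_child y_ts.
Qed.

Lemma rename_comp p q t : rename p (rename q t) = rename (p \o q) t.
Proof.
elim/ltree_ind: t => x f ts IH; rewrite !rename_LNode; apply: eq_LNode => [|i].
  by case: x.
by rewrite !ffunE.
Qed.

Lemma rename_id t : rename id t = t.
Proof.
elim/ltree_ind: t => x f ts IH; rewrite rename_LNode; apply: eq_LNode => [|i].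
  by case: x.
by rewrite !ffunE.
Qed.

(** On the names of [t], which differ from [c] and from a fresh [d], exchanging [a] with [c] and
    then [c] with [d] acts as exchanging [a] with [d]. *)
Lemma abs_eq_fresh a c t : infinitely_many A -> c \notin names t ->
  abs_eq a t c (rename (swap a c) t).
Proof.
move=> infA c_t; have [d] := infA
  (a :: c :: names t ++ names (rename (swap a c) t)).
rewrite !inE mem_cat !negb_or => /and4P[da dc d_t d_t'].
exists d; split=> //; rewrite rename_comp; apply: eq_in_rename => x x_t /=.
have xc : x != c by apply: contraNneq c_t => <-.
have xd : x != d by apply: contraNneq d_t => <-.
rewrite /swap; case: (eqVneq x a) => _; first by rewrite eqxx.
by rewrite (negPf xc) (negPf xd) (negPf xc).
Qed.

End Renaming.

(** * Normal forms relative to an environment *)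

Section NormalForm.
Variables (A : eqType) (F : Type) (ar : F -> nat).
Implicit Types (a b c : A) (s t : bartree A ar) (k : nat) (e : A -> A + nat).

Fixpoint nf_env k e t : ltree (A + nat) ar :=
  match t with
  | Node g ts =>
      match g.1 with
      | Plain a => @LNode _ _ ar (e a) g.2 [ffun i => nf_env k e (ts i)]
      | Bar a => @LNode _ _ ar (inr k.+1) g.2
          [ffun i => nf_env k.+1 [eta e with a |-> inr k.+1] (ts i)]
      end
  end.

Lemma nf_env_Plain k e a f (ts : {ffun 'I_(ar f) -> bartree A ar}) :
  nf_env k e (LNode (Plain a) ts) = LNode (e a) [ffun i => nf_env k e (ts i)].
Proof. by []. Qed.

Lemma nf_env_Bar k e a f (ts : {ffun 'I_(ar f) -> bartree A ar}) :
  nf_env k e (LNode (Bar a) ts) =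
  LNode (inr k.+1)
    [ffun i => nf_env k.+1 [eta e with a |-> inr k.+1] (ts i)].
Proof. by []. Qed.

Definition nf_run (w : seq (barname A)) : seq (barname A * (A + nat)) :=
  foldl (fun u x => rcons u (x, nf_letter u x)) [::] w.

Lemma nf_run_rcons w x :
  nf_run (rcons w x) = rcons (nf_run w) (x, nf_letter (nf_run w) x).
Proof. by rewrite /nf_run foldl_rcons. Qed.

Lemma last_nf_string z w x :
  last z (nf_string (rcons w x)) = nf_letter (nf_run w) x.
Proof.
by rewrite /nf_string -/(nf_run _) nf_run_rcons /unzip2 map_rcons last_rcons.
Qed.

Lemma count_nf_run w :
  count (fun y => is_bar y.1) (nf_run w) = count (@is_bar A) w.
Proof.
elim/last_ind: w => // w x IH.
by rewrite nf_run_rcons -!cats1 !count_cat IH.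
Qed.

Lemma eq_in_nf_env k e1 e2 t :
  {in names t, e1 =1 e2} -> nf_env k e1 t = nf_env k e2 t.
Proof.
elim/ltree_ind: t k e1 e2 => -[] a f ts IH k e1 e2 eq_e.
  rewrite !nf_env_Plain (eq_e a (mem_names_label (Plain a) ts)).
  apply: eq_LNode => // i.
  rewrite !ffunE; apply: IH => y y_ts.
  by apply: eq_e; apply: mem_names_child y_ts.
rewrite !nf_env_Bar; apply: eq_LNode => // i.
rewrite !ffunE; apply: IH => y y_ts /=.
by rewrite (eq_e y) //; apply: mem_names_child y_ts.
Qed.

Lemma nf_below_LNode w x f (ts : {ffun 'I_(ar f) -> bartree A ar}) :
  nf_below w (LNode x ts) =
  LNode (nf_letter (nf_run w) x) [ffun i => nf_below (rcons w x) (ts i)].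
Proof. by rewrite -(last_nf_string (inr 0)). Qed.

(** Appending [Plain a] to [w] leaves the letters of plain names unchanged; appending [Bar a]
    changes only that of [a], to the new count of bar names. *)
Lemma nf_belowE w t :
  nf_below w t =
  nf_env (count (@is_bar A) w) (fun a => nf_letter (nf_run w) (Plain a)) t.
Proof.
elim/ltree_ind: t w => -[] a f ts IH w; rewrite nf_below_LNode.
  rewrite nf_env_Plain; apply: eq_LNode => // i.
  rewrite !ffunE IH -{1}cats1 count_cat addn0; apply: eq_in_nf_env => y _.
  by rewrite nf_run_rcons /= filter_rcons.
rewrite nf_env_Bar -count_nf_run; apply: eq_LNode => // i.
rewrite !ffunE IH -{1}cats1 count_cat addn1 -count_nf_run.
apply: eq_in_nf_env => y _; rewrite nf_run_rcons /= filter_rcons /=.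
rewrite -[Bar a == Bar y]/(a == y) eq_sym.
by case: eqVneq => // _; rewrite rev_rcons.
Qed.

Lemma nf_treeE t : nf_tree t = nf_env 0 inl t.
Proof. exact: nf_belowE. Qed.

Lemma nf_env_rename k e (p : A -> A) t : injective p ->
  nf_env k e (rename p t) = nf_env k (e \o p) t.
Proof.
move=> p_inj; elim/ltree_ind: t k e => -[] a f ts IH k e; rewrite rename_LNode.
  rewrite !nf_env_Plain; apply: eq_LNode => // i.
  by rewrite !ffunE.
rewrite !nf_env_Bar; apply: eq_LNode => // i.
rewrite !ffunE IH; apply: eq_in_nf_env => y _ /=.
(* Injectivity turns the update at [p a], precomposed with [p], into the update at [a]. *)
by rewrite (inj_eq p_inj).
Qed.

Lemma nf_env_swap k e m a c t : c \notin names t ->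
  nf_env k [eta e with c |-> m] (rename (swap a c) t) =
  nf_env k [eta e with a |-> m] t.
Proof.
move=> c_t; rewrite nf_env_rename; last exact: inv_inj (swapK a c).
apply: eq_in_nf_env => x x_t /=.
have xc : x != c by apply: contraNneq c_t => <-.
rewrite /swap; case: (eqVneq x a) => _; first by rewrite eqxx.
by rewrite (negPf xc) (negPf xc).
Qed.

Lemma alpha_eq_nf_env k e s t : alpha_eq s t -> nf_env k e s = nf_env k e t.
Proof.
move=> st; elim: st k e => {s t}.
- by [].
- by move=> s t _ IH k e; rewrite IH.
- by move=> s t u _ IHst _ IHtu k e; rewrite IHst.
- move=> [] a f ss ts _ IH k e; rewrite ?nf_env_Plain ?nf_env_Bar;
    by apply: eq_LNode => // i; rewrite !ffunE.
move=> a b f ss ts st k e; rewrite !nf_env_Bar; apply: eq_LNode => // i.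
rewrite !ffunE; have [c [_ _ c_s c_t eq_st]] := st i.
(* Both sides are the normal form of the common renamed tree, with [c] sent to [inr k.+1]. *)
by rewrite -(nf_env_swap _ _ _ _ c_s) -(nf_env_swap _ _ _ _ c_t) eq_st.
Qed.

(** * From equal normal forms to alpha-equivalence *)

Definition env_below k e := forall x m, e x = inr m -> m <= k.

Lemma env_below_with k e c : env_below k e ->
  env_below k.+1 [eta e with c |-> inr k.+1].
Proof.
move=> e_le x m /=; case: eqP => _; first by move=> [<-].
by move/e_le/leqW.
Qed.

(** By the bound, [inr k.+1] is not a value of [e], so the updated entry collides with no other. *)
Lemma env_with_inj k e c : env_below k e -> injective e ->
  injective [eta e with c |-> inr k.+1].
Proof.
move=> e_le e_inj x y /=; case: eqP => [->|_]; case: eqP => [->|_] //.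
- by move/esym/e_le; rewrite ltnn.
- by move/e_le; rewrite ltnn.
exact: e_inj.
Qed.

(* The induction is on [s] while the recursion renames it, hence the
   quantification over [p]. *)
Lemma nf_env_alpha_eq_rename k e (p : A -> A) s t :
  infinitely_many A -> env_below k e -> injective e ->
  nf_env k e (rename p s) = nf_env k e t -> alpha_eq (rename p s) t.
Proof.
move=> infA; elim/ltree_ind: s k e p t => x f ss IH k e p t.
elim/ltree_ind: t => y f' ts _ e_le e_inj; rewrite rename_LNode.
case: x => a; case: y => b /=.
all: rewrite ?nf_env_Plain ?nf_env_Bar => eq_st;
  have {eq_st} [] := LNode_inj eq_st.
- move/e_inj => ab [E]; case: f' / E ts => ts eq_st; rewrite ab.
  apply: alpha_congr => i; have := eq_st i; rewrite cast_ord_id !ffunE.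
  exact: IH.
(* In the two mixed cases a plain name would have the letter [inr k.+1], above the bound. *)
- by move/e_le; rewrite ltnn.
- by move/esym/e_le; rewrite ltnn.
move=> _ [E]; case: f' / E ts => ts eq_st.
set ss' := [ffun i => rename p (ss i)].
have [c] := infA (names (LNode (Bar a) ss') ++ names (LNode (Bar b) ts)).
rewrite mem_cat negb_or => /andP[c_s c_t].
have {}c_s i : c \notin names (ss' i).
  by apply: contra c_s; apply: mem_names_child.
have {}c_t i : c \notin names (ts i).
  by apply: contra c_t; apply: mem_names_child.
(* Both root names are replaced by the fresh [c], so that only the children remain to be
   compared. *)
apply: (@alpha_trans _ _ _ _
  (LNode (Bar c) [ffun i => rename (swap (p a) c) (ss' i)])).
  by apply: alpha_bar => i; rewrite [in X in abs_eq _ _ _ X]ffunE;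
    apply: abs_eq_fresh.
apply: (@alpha_trans _ _ _ _
  (LNode (Bar c) [ffun i => rename (swap b c) (ts i)])); last first.
  by apply/alpha_sym/alpha_bar => i; rewrite [in X in abs_eq _ _ _ X]ffunE;
    apply: abs_eq_fresh.
(* Absorbing the swap into [p] leaves a renaming of [ss i] itself, to which the induction hypothesis
   applies. *)
apply: alpha_congr => i; rewrite !ffunE rename_comp.
apply: (IH i k.+1 [eta e with c |-> inr k.+1]).
- exact: env_below_with.
- exact: env_with_inj.
have := c_s i; rewrite ffunE => c_si.
(* Both swaps are traded for updates at [p a] and at [b], as in the given equality of normal
   forms. *)
rewrite -rename_comp !nf_env_swap //.
by have := eq_st i; rewrite cast_ord_id !ffunE.
Qed.

Lemma nf_env_alpha_eq k e s t :
  infinitely_many A -> env_below k e -> injective e ->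
  nf_env k e s = nf_env k e t -> alpha_eq s t.
Proof.
by rewrite -{1 2}(rename_id s); apply: nf_env_alpha_eq_rename.
Qed.

End NormalForm.

Theorem proposition4p8 (A : countType) (hA : infinitely_many A)
    (Sigma : finType) (ar : Sigma -> nat) (s t : bartree A ar) :
  alpha_eq s t <-> nf_tree s = nf_tree t.
Proof.
rewrite !nf_treeE; split; first exact: alpha_eq_nf_env.
(* [inl] is injective and yields no number, so the bound 0 holds vacuously. *)
by apply: nf_env_alpha_eq => // x y [].
Qed.
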